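(* Let $n$ be a positive integer and $m=\lfloor (n-1)/2\rfloor$. Then the polynomials $R_n^{D}(t)$, $R_n^{B-D}(t)$, $R_n^{D,+}(t)$, $R_n^{D,-}(t)$, $R_n^{B-D,+}(t)$ and $R_n^{B-D,-}(t)$ are all divisible by $(1+t)^m$.
   Context: $\mathfrak{B}_n$ is the group of signed permutations in window notation $\pi=\pi_1\cdots\pi_n$, and $\mathfrak{D}_n$ the subset with an even number of negative entries. For $\pi\in\mathfrak{B}_n$, $\mathrm{inv}_D(\pi)=|\{i<j:\pi_i>\pi_j\}|+|\{i<j:-\pi_i>\pi_j\}|$. Let $\mathfrak{D}_n^+=\{\pi\in\mathfrak{D}_n:\mathrm{inv}_D(\pi)\text{ even}\}$, $\mathfrak{D}_n^-=\mathfrak{D}_n\setminus\mathfrak{D}_n^+$, $(\mathfrak{B}_n\setminus\mathfrak{D}_n)^+=\{\pi\in\mathfrak{B}_n\setminus\mathfrak{D}_n:\mathrm{inv}_D(\pi)\text{ even}\}$ and $(\mathfrak{B}_n\setminus\mathfrak{D}_n)^-$ its complement in $\mathfrak{B}_n\setminus\mathfrak{D}_n$. Set $\pi_0=0$; $\mathrm{pk}_D(\pi)$ (resp. $\mathrm{val}_D(\pi)$) is the number of $i\in\{1,\dots,n-1\}$ with $\pi_{i-1}<\pi_i>\pi_{i+1}$ (resp. $\pi_{i-1}>\pi_i<\pi_{i+1}$), and $\mathrm{altruns}_D(\pi)=\mathrm{pk}_D(\pi)+\mathrm{val}_D(\pi)+1$. Define $R_n^D,R_n^{B-D},R_n^{D,\pm},R_n^{B-D,\pm}$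 as $\sum t^{\mathrm{altruns}_D(\pi)}$ over $\mathfrak{D}_n$, $\mathfrak{B}_n\setminus\mathfrak{D}_n$, $\mathfrak{D}_n^{\pm}$, $(\mathfrak{B}_n\setminus\mathfrak{D}_n)^{\pm}$ respectively. *)

(* Defs.v *)
From mathcomp Require Import all_boot all_order all_fingroup all_algebra.

Set Implicit Arguments.
Unset Strict Implicit.
Unset Printing Implicit Defensive.

Import Order.TTheory GRing.Theory Num.Theory.
Local Open Scope ring_scope.

(* A signed permutation is stored as the permutation of its absolute values
   together with its sign pattern (true = negative). *)
Definition signed_perm (n : nat) : finType := ('S_n * {ffun 'I_n -> bool})%type.

(* 'I_n is 0-based: entry p i is the mathematical pi_{i+1}, whose absolute
   value is p.1 i + 1. *)
Definition entry (n : nat) (p : signed_perm n) (i : 'I_n) : int :=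
  (-1) ^+ p.2 i * (p.1 i).+1%:Z.

(* The encoding is a bijection onto the words w_1 ... w_n of integers such that
   |w_1| ... |w_n| is a rearrangement of 1 ... n. *)
Lemma entry_inj (n : nat) (p q : signed_perm n) : entry p =1 entry q -> p = q.
Proof.
case: p q => [s e] [s' e'] pq; congr pair.
  apply/permP => i; apply: val_inj; move: (congr1 absz (pq i)).
  by rewrite /entry !abszM !abszX !exp1n !mul1n !absz_nat => -[].
apply/ffunP => i; move: (pq i); rewrite /entry /=.
by case: (e i); case: (e' i); rewrite ?expr0 ?expr1 ?mul1r ?mulN1r.
Qed.

Lemma entry_abs_perm (n : nat) (p : signed_perm n) :
  perm_eq [seq `|entry p i|%N | i : 'I_n] (iota 1 n).
Proof.
rewrite (@eq_image _ _ _ _ _ (fun i => (p.1 i).+1) (frefl _)); last first.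
  by move=> i; rewrite /entry abszM abszX exp1n mul1n.
apply: uniq_perm; rewrite ?iota_uniq //.
  by rewrite map_inj_uniq ?enum_uniq // => i j [] /val_inj /perm_inj.
move=> k; rewrite mem_iota add1n ltnS; apply/mapP/andP => [[i _ ->]|[k0 kn]].
  by rewrite ltn_ord.
have kn1 : (k.-1 < n)%N by rewrite prednK.
exists (p.1^-1 (Ordinal kn1))%g; first by rewrite mem_enum.
by rewrite permKV /= prednK.
Qed.

Lemma entry_surj (n : nat) (w : 'I_n -> int) :
  perm_eq [seq `|w i|%N | i : 'I_n] (iota 1 n) ->
  exists p : signed_perm n, entry p =1 w.
Proof.
move=> hw.
have wb i : (0 < `|w i| <= n)%N.
  have: `|w i|%N \in [seq `|w i|%N | i : 'I_n] by apply: map_f; rewrite mem_enum.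
  by rewrite (perm_mem hw) mem_iota add1n ltnS.
have wn i : (`|w i|.-1 < n)%N by case/andP: (wb i) => w0; rewrite prednK.
have /injectiveP f_inj : injectiveb (fun i => `|w i|%N).
  by rewrite /injectiveb /dinjectiveb (perm_uniq hw) iota_uniq.
have s_inj : injective (fun i => Ordinal (wn i)).
  move=> i j [] /(congr1 succn); case/andP: (wb i) => wi _.
  by case/andP: (wb j) => wj _; rewrite !prednK // => /f_inj.
exists (perm s_inj, [ffun i => w i < 0]) => i.
rewrite /entry /= permE ffunE /= prednK; last by case/andP: (wb i).
by rewrite [RHS]intEsign.
Qed.

(* wordD p k is pi_k for 0 <= k <= n, with the convention pi_0 = 0. *)
Definition wordD (n : nat) (p : signed_perm n) (k : nat) : int :=
  (0 :: [seq entry p i | i : 'I_n])`_k.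

Definition invD (n : nat) (p : signed_perm n) : nat :=
  #|[set ij : 'I_n * 'I_n | (ij.1 < ij.2)%N && (entry p ij.1 > entry p ij.2)]| +
  #|[set ij : 'I_n * 'I_n | (ij.1 < ij.2)%N && (- entry p ij.1 > entry p ij.2)]|.

(* In pkD and valD the conditions i : 'I_n and 0 < i say 1 <= i <= n - 1. *)
Definition pkD (n : nat) (p : signed_perm n) : nat :=
  #|[set i : 'I_n | [&& (0 < i)%N, wordD p i.-1 < wordD p i
                                 & wordD p i > wordD p i.+1]]|.

Definition valD (n : nat) (p : signed_perm n) : nat :=
  #|[set i : 'I_n | [&& (0 < i)%N, wordD p i.-1 > wordD p i
                                 & wordD p i < wordD p i.+1]]|.

Definition altrunsD (n : nat) (p : signed_perm n) : nat := (pkD p + valD p).+1.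

Definition Dset (n : nat) : {set signed_perm n} :=
  [set p | ~~ odd #|[set i | entry p i < 0]|].
Definition BDset (n : nat) : {set signed_perm n} := ~: Dset n.

Definition Dplus (n : nat) : {set signed_perm n} :=
  [set p in Dset n | ~~ odd (invD p)].
Definition Dminus (n : nat) : {set signed_perm n} := Dset n :\: Dplus n.
Definition BDplus (n : nat) : {set signed_perm n} :=
  [set p in BDset n | ~~ odd (invD p)].
Definition BDminus (n : nat) : {set signed_perm n} := BDset n :\: BDplus n.

Definition altruns_poly (n : nat) (A : {set signed_perm n}) : {poly int} :=
  \sum_(p in A) 'X^(altrunsD p).

Definition RD (n : nat) : {poly int} := altruns_poly (Dset n).
Definition RBD (n : nat) : {poly int} := altruns_poly (BDset n).
Definition RDplus (n : nat) : {poly int} := altruns_poly (Dplus n).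
Definition RDminus (n : nat) : {poly int} := altruns_poly (Dminus n).
Definition RBDplus (n : nat) : {poly int} := altruns_poly (BDplus n).
Definition RBDminus (n : nat) : {poly int} := altruns_poly (BDminus n).

(* Divisibility in Z[t]; polydiv's %| is pseudo-divisibility over int, for which
   for instance 2 divides 1. *)
Definition zpoly_dvd (d p : {poly int}) : Prop := exists q : {poly int}, p = q * d.

(* Main.v *)
(** Negating the last [2r+2] entries of [pi], for [r < m], keeps the parity of
    the number of negative entries, and keeps the parity of [invD], which only
    depends on the absolute values. It reverses all comparisons inside the
    suffix, and the comparison across the cut is reversed exactly when the
    larger absolute value lies in the suffix; hence the alternation of
    [0 pi_1 ... pi_n] is toggled at exactly one of the two positions next to the
    cut, chosen by the absolute values alone. The [m] cuts use disjoint pairs of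
    positions, so each of them contributes an independent factor [1 + t]. *)

Require Import Defs.
From mathcomp Require Import all_boot all_order all_fingroup all_algebra.
From mathcomp Require Import zify.

Import Order.TTheory GRing.Theory Num.Theory.
Local Open Scope ring_scope.

(** Induction on [m]. The involution [c m] exchanges the halves of [A] where [b m] holds and fails,
    changing the exponent by one, so the sum is [1 + 'X] times the sum over the half where [b m]
    fails. The [c r] with [r < m] preserve that half, since they leave [b m] unchanged. *)
Lemma zpoly_dvd_toggles (T : finType) (c : nat -> T -> T) (b : nat -> T -> bool)
    (g : T -> nat) (m : nat) (A : {set T}) :
    (forall r, (r < m)%N -> involutive (c r)) ->
    (forall r p, (r < m)%N -> (c r p \in A) = (p \in A)) ->
    (forall r p, (r < m)%N -> g (c r p) = g p) ->
    (forall r r' p, (r < m)%N -> (r' < m)%N ->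
       b r' (c r p) = (r' == r) (+) b r' p) ->
  zpoly_dvd ((1 + 'X) ^+ m) (\sum_(p in A) 'X^(g p + \sum_(r < m) b r p)%N).
Proof.
elim: m A => [|m IHm] A cK cA gc bc.
  by exists (\sum_(p in A) 'X^(g p)); rewrite expr0 mulr1;
    apply: eq_bigr => p _; rewrite big_ord0 addn0.
have ltW r : (r < m)%N -> (r < m.+1)%N by move=> ltrm; rewrite ltnS ltnW.
have [|r p ltrm|r p ltrm|r r' p ltrm ltr'm|q Dq] :=
    IHm (A :&: [set p | ~~ b m p]).
- by move=> r /ltW; apply: cK.
- by rewrite !inE cA ?ltW // bc // ?ltW // gtn_eqF.
- by rewrite gc ?ltW.
- by rewrite bc ?ltW.
exists q; rewrite exprSr mulrA -Dq mulrDr mulr1 addrC.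
rewrite (bigID (b m)) /=; congr (_ + _).
  rewrite (reindex_inj (inv_inj (cK m (ltnSn m)))) mulr_suml.
  apply: eq_big => [p|p]; first by rewrite !inE cA // bc // eqxx.
  rewrite cA // bc // eqxx => /andP[_ nbp].
  rewrite big_ord_recr /= bc // eqxx nbp gc // addn1 addnS exprSr.
  congr ('X^(_ + _) * _); apply: eq_bigr => r _.
  by rewrite bc // ?ltW // ltn_eqF.
apply: eq_big => [p|p /andP[_ /negPf nbp]]; first by rewrite !inE.
by rewrite big_ord_recr /= nbp addn0.
Qed.

Lemma odd_card_set (T : finType) (P : pred T) :
  odd #|[set x | P x]| = \big[addb/false]_x P x.
Proof.
rewrite -sum1dep_card big_mkcond /= (big_morph odd oddD (erefl _)).
by apply: eq_bigr => x _; case: (P x).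
Qed.

Lemma entry_lt0 (n : nat) (p : signed_perm n) (i : 'I_n) : (entry p i < 0) = p.2 i.
Proof. by rewrite /entry; case: (p.2 i); rewrite ?mulN1r ?mul1r. Qed.

Lemma absz_entry (n : nat) (p : signed_perm n) (i : 'I_n) :
  `|entry p i|%N = (p.1 i).+1.
Proof. by rewrite abszM abszX exp1n mul1n. Qed.

(** For [i < j], if [pi_i] has the larger absolute value, exactly one of [pi_i] and [- pi_i] exceeds
    [pi_j]; otherwise both or neither do, which vanishes modulo 2. *)
Lemma odd_invD (n : nat) (p : signed_perm n) :
  odd (invD p)
  = \big[addb/false]_(ij : 'I_n * 'I_n) ((ij.1 < ij.2)%N && (p.1 ij.2 < p.1 ij.1)%N).
Proof.
rewrite oddD !odd_card_set -big_split /=; apply: eq_bigr => -[i j] _ /=.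
case: ltnP => //= ltij.
have nij : p.1 i != p.1 j :> nat.
  by rewrite val_eqE (inj_eq perm_inj) -val_eqE ltn_eqF.
move: (absz_entry _ p i) (absz_entry _ p j) nij.
by move: (entry p i) (entry p j) (nat_of_ord (p.1 i)) (nat_of_ord (p.1 j)); lia.
Qed.

(** Ordinals being 0-based, the negated entries are [pi_k] with [s < k]: the cut lies between
    positions [s] and [s.+1] of [wordD]. *)
Definition negate_from {n : nat} (s : nat) (p : signed_perm n) : signed_perm n :=
  (p.1, [ffun i : 'I_n => (s <= i)%N (+) p.2 i]).

Lemma negate_fromK (n s : nat) : involutive (@negate_from n s).
Proof.
by case=> u e; congr pair; apply/ffunP => i; rewrite !ffunE addbA addbb.
Qed.

Lemma odd_invD_negate_from (n s : nat) (p : signed_perm n) :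
  odd (invD (negate_from s p)) = odd (invD p).
Proof. by rewrite !odd_invD. Qed.

Lemma mem_Dset_negate_from (n s : nat) (p : signed_perm n) :
  (s <= n)%N -> ~~ odd (n - s) -> (negate_from s p \in Dset n) = (p \in Dset n).
Proof.
move=> lesn ev; rewrite !inE !odd_card_set; congr (~~ _).
under eq_bigr do rewrite entry_lt0 ffunE.
under [RHS]eq_bigr do rewrite entry_lt0.
rewrite big_split /= -odd_card_set -[RHS]addFb; congr (_ (+) _).
apply/negbTE; suff -> : #|[set i : 'I_n | (s <= i)%N]| = (n - s)%N by [].
rewrite -sum1dep_card -(big_mkord (fun i => s <= i)%N (fun=> 1%N)).
rewrite (big_cat_nat (n := s)) //= big_nat_cond big_pred0 => [|i]; last by lia.
rewrite add0n big_nat_cond (eq_bigl (fun i => (s <= i < n)%N)) => [|i]; last by lia.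
by rewrite -big_nat sum_nat_const_nat muln1.
Qed.

Lemma wordDS (n : nat) (p : signed_perm n) (i : 'I_n) : wordD p i.+1 = entry p i.
Proof.
by rewrite /wordD /= (nth_map i) ?size_enum_ord // nth_ord_enum.
Qed.

Lemma wordD_negate_from (n s k : nat) (p : signed_perm n) :
  (k <= n)%N -> wordD (negate_from s p) k = (-1) ^+ (s < k)%N * wordD p k.
Proof.
case: k => [|k] ltkn; first by rewrite mulr0.
rewrite -[k]/(nat_of_ord (Ordinal ltkn)) !wordDS /entry ffunE ltnS.
by rewrite mulrA signr_addb.
Qed.

(** Excludes ties between neighbours, whatever signs they receive; for [k = 0] this is the
    convention [pi_0 = 0]. *)
Lemma norm_wordD_neq (n k : nat) (p : signed_perm n) :
  (k < n)%N -> `|wordD p k| != `|wordD p k.+1|.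
Proof.
move=> ltkn; rewrite (wordDS _ p (Ordinal ltkn)).
have := absz_entry _ p (Ordinal ltkn).
case: k ltkn => [|k] ltkn; first by rewrite /wordD /=; lia.
rewrite (wordDS _ p (Ordinal (ltnW ltkn))).
have := absz_entry _ p (Ordinal (ltnW ltkn)).
have : p.1 (Ordinal (ltnW ltkn)) != p.1 (Ordinal ltkn) :> nat.
  by rewrite val_eqE (inj_eq perm_inj) -val_eqE /= ltn_eqF.
move: (entry p _) (entry p _) (nat_of_ord (p.1 _)) (nat_of_ord (p.1 _)); lia.
Qed.

Definition ascent {n : nat} (p : signed_perm n) (k : nat) : bool :=
  wordD p k < wordD p k.+1.

Definition norm_ascent {n : nat} (p : signed_perm n) (k : nat) : bool :=
  `|wordD p k| < `|wordD p k.+1|.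

Definition turn {n : nat} (p : signed_perm n) (k : nat) : bool :=
  ascent p k.-1 (+) ascent p k.

Lemma norm_ascent_negate_from (n s k : nat) (p : signed_perm n) :
  (k < n)%N -> norm_ascent (negate_from s p) k = norm_ascent p k.
Proof.
move=> ltkn; rewrite /norm_ascent !wordD_negate_from ?(ltnW ltkn) //.
by rewrite !normrMsign.
Qed.

(** The neighbour of larger absolute value decides the comparison by its sign alone, so the ascent
    flips exactly when that neighbour lies past the cut. *)
Lemma ascent_negate_from (n s k : nat) (p : signed_perm n) : (k < n)%N ->
  ascent (negate_from s p) k
  = (if norm_ascent p k then s <= k else s < k)%N (+) ascent p k.
Proof.
move=> ltkn; rewrite /ascent /norm_ascent !wordD_negate_from ?(ltnW ltkn) //.
move: (norm_wordD_neq _ _ p ltkn); move: (wordD p k) (wordD p k.+1) => x y.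
rewrite ltnS; case: (ltnP s k); case: (leqP s k) => //= *;
  by rewrite ?expr0 ?expr1 ?mul1r ?mulN1r; case: (ltP `|x| `|y|); lia.
Qed.

(** The flipped ascents form a final segment starting at [s] or [s.+1]; an exclusive or of
    consecutive ascents changes only where that segment starts. *)
Lemma turn_negate_from (n s k : nat) (p : signed_perm n) : (0 < k < n)%N ->
  turn (negate_from s p) k
  = (k == (if norm_ascent p s then s else s.+1)) (+) turn p k.
Proof.
case: k => [|k] //= ltkn; rewrite /turn /= !ascent_negate_from ?(ltnW ltkn) //.
rewrite addbACA; congr (_ (+) _).
have [->|nk] := eqVneq s k; first by case: (norm_ascent p k); case: ifP; lia.
have [->|nk1] := eqVneq s k.+1; first by do 2!case: ifP; lia.
by do !case: ifP; lia.
Qed.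

Lemma altrunsD_turns (n : nat) (p : signed_perm n) :
  altrunsD p = (\sum_(1 <= k < n) turn p k).+1%N.
Proof.
congr S; rewrite /pkD /valD -!sum1dep_card big_mkcond [X in (_ + X)%N]big_mkcond -big_split /=.
rewrite -(big_mkord xpredT (fun k : nat =>
  addn (if [&& (0 < k)%N, wordD p k.-1 < wordD p k & wordD p k > wordD p k.+1]
        then 1%N else 0%N)
       (if [&& (0 < k)%N, wordD p k.-1 > wordD p k & wordD p k < wordD p k.+1]
        then 1%N else 0%N))).
case: n p => [|n] p; first by rewrite !big_geq.
(* Index 0 contributes nothing. Elsewhere, without ties, a turn is a peak or a valley, never
   both. *)
rewrite big_ltn //= add0n; apply: eq_big_nat => -[|k] //= ltkn.
have := norm_wordD_neq _ _ p ltkn; have := norm_wordD_neq _ _ p (ltnW ltkn).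
rewrite /turn /ascent /=; move: (wordD p k) (wordD p k.+1) (wordD p k.+2) => x y z.
by case: (ltgtP y z) => [_|_|->]; case: (ltgtP x y) => [_|_|->]; rewrite ?eqxx.
Qed.

(** Pairs are peeled off from the top; the [r]-th consists of the two positions next to the cut at
    [n - r.+1.*2]. *)
Lemma sum_nat_pairs (F : nat -> nat) (n j : nat) : (j.*2 < n)%N ->
  (\sum_(1 <= k < n) F k)%N
  = (\sum_(1 <= k < n - j.*2) F k
     + \sum_(r < j) (F (n - r.+1.*2) + F (n - r.+1.*2).+1))%N.
Proof.
elim: j => [|j IHj] ltjn; first by rewrite big_ord0 addn0 subn0.
rewrite IHj; last by lia.
rewrite big_ord_recr /= [LHS]addnC [RHS]addnCA; congr addn.
have -> : (n - j.*2 = (n - j.+1.*2).+2)%N by lia.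
by rewrite !big_nat_recr ?addnA //=; lia.
Qed.

Lemma zpoly_dvd_altruns_poly (n m : nat) (A : {set signed_perm n}) :
    (m.*2 < n)%N ->
    (forall s p, (s <= n)%N -> ~~ odd (n - s) ->
       (negate_from s p \in A) = (p \in A)) ->
  zpoly_dvd ((1 + 'X) ^+ m) (altruns_poly A).
Proof.
move=> ltmn Ac; pose s (r : nat) := (n - r.+1.*2)%N.
(* In the pair at cut [s r], [free] is the position toggled by that cut and [fixed] the other
   one. *)
pose free (p : signed_perm n) (r : nat) := if norm_ascent p (s r) then s r else (s r).+1.
pose fixed (p : signed_perm n) (r : nat) := if norm_ascent p (s r) then (s r).+1 else s r.
pose g (p : signed_perm n) := (\sum_(1 <= k < n - m.*2) turn p k
             + \sum_(r < m) turn p (fixed p r)).+1%N.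
have -> : altruns_poly A
    = \sum_(p in A) 'X^(g p + \sum_(r < m) turn p (free p r))%N.
  apply: eq_bigr => p _; congr 'X^_.
  rewrite altrunsD_turns (sum_nat_pairs _ _ _ ltmn) addSn -addnA -big_split.
  congr (_ + _).+1; apply: eq_bigr => r _.
  by rewrite /fixed /free /=; case: ifP => // _; rewrite addnC.
have nac r r' (p : signed_perm n) : (r' < m)%N ->
    norm_ascent (negate_from (s r) p) (s r') = norm_ascent p (s r').
  by move=> ltr'm; apply: norm_ascent_negate_from; rewrite /s; lia.
apply: (zpoly_dvd_toggles _ (fun r => negate_from (s r))
  (fun r p => turn p (free p r)) g).
- by move=> r _; apply: negate_fromK.
- by move=> r p ltrm; apply: Ac; rewrite /s; lia.
(* Positions below [n - m.*2] precede every cut, and a [fixed] position is either in another pair or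
   the untoggled one of its own. *)
- move=> r p ltrm; congr (_ + _).+1.
    apply: eq_big_nat => k /andP[k0 ltk]; rewrite turn_negate_from; last by lia.
    by rewrite (_ : (k == _) = false) //; case: ifP; rewrite /s; lia.
  apply: eq_bigr => -[r' ltr'm] _ /=; rewrite /fixed nac //.
  rewrite turn_negate_from; last by case: ifP; rewrite /s; lia.
  rewrite (_ : (_ == _) = false) //.
  have [->|ne] := eqVneq r' r; first by case: ifP; lia.
  by do 2!case: ifP; rewrite /s; lia.
move=> r r' p ltrm ltr'm; rewrite /free nac //.
rewrite turn_negate_from; last by case: ifP; rewrite /s; lia.
congr (_ (+) _); have [->|ne] := eqVneq r' r; first by rewrite eqxx.
by do 2!case: ifP; rewrite /s; lia.
Qed.

Theorem theorem54 (n m : nat) (n_gt0 : (0 < n)%N) (m_def : m = ((n - 1) %/ 2)%N) :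
  zpoly_dvd ((1 + 'X) ^+ m) (RD n) /\
  zpoly_dvd ((1 + 'X) ^+ m) (RBD n) /\
  zpoly_dvd ((1 + 'X) ^+ m) (RDplus n) /\
  zpoly_dvd ((1 + 'X) ^+ m) (RDminus n) /\
  zpoly_dvd ((1 + 'X) ^+ m) (RBDplus n) /\
  zpoly_dvd ((1 + 'X) ^+ m) (RBDminus n).
Proof.
have ltmn : (m.*2 < n)%N by lia.
have Dc := mem_Dset_negate_from n.
have Ic := odd_invD_negate_from n.
have BDc s (p : signed_perm n) : (s <= n)%N -> ~~ odd (n - s) ->
    (negate_from s p \in BDset n) = (p \in BDset n).
  by move=> lesn ev; rewrite ![_ \in BDset n]in_setC Dc.
have Dpc s (p : signed_perm n) : (s <= n)%N -> ~~ odd (n - s) ->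
    (negate_from s p \in Dplus n) = (p \in Dplus n).
  by move=> lesn ev; rewrite ![_ \in Dplus n]in_set Dc // Ic.
have BDpc s (p : signed_perm n) : (s <= n)%N -> ~~ odd (n - s) ->
    (negate_from s p \in BDplus n) = (p \in BDplus n).
  by move=> lesn ev; rewrite ![_ \in BDplus n]in_set BDc // Ic.
(* Only the two minus classes remain, as differences of stable sets. *)
do !split; apply: zpoly_dvd_altruns_poly => // s p lesn ev.
  by rewrite !in_setD Dpc // Dc.
by rewrite !in_setD BDpc // BDc.
Qed.
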